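(* Let $\Gamma$ be a simple locally finite graph and let $\{v_n\}_{n\in\mathbb N}$ be a sequence of vertices of $\Gamma$. For $n,k\in\mathbb N$, let $s_n^k$ denote the number of vertices $w$ adjacent to $v_n$ with $d(w)\leq k$, and let $d_n=d(v_n)$. Suppose that (1) $\lim_{n\to\infty}d_n=\infty$; (2) $\limsup_{n\to\infty}\frac{s_n^k}{d_n}>0$ for some $k\in\mathbb N$. Then $\Gamma$ is not approximately uniformly locally finite (AULF).
   Context: All graphs are simple (no loops or multiple edges) and locally finite (every vertex has finitely many adjacent vertices), but not necessarily connected. For a graph $\Gamma$ with vertex set $V$, $d(v)$ is the degree of $v\in V$, $v\sim w$ means that $v$ and $w$ are adjacent, and $l^2(\Gamma)$ is the Hilbert space of square-summable complex functions on $V$, with orthonormal basis $\{\delta_v\}_{v\in V}$ of characteristic functions of vertices (the standard basis). The normalized Laplacian $L$ of $\Gamma$ is the bounded operator on $l^2(\Gamma)$ given by $Lf(v)=f(v)-\sum_{w\sim v}\frac{1}{\sqrt{d(v)d(w)}}f(w)$ (the sum is empty if $v$ is isolated). For $d\in\mathbb N$, $\mathbb B^{(d)}$ is the set of bounded operators on $l^2(\Gamma)$ whose matrix with respect to the standard basis has at most $d$ non-zero entries in each row and in each column. Put $\mathbb B^{(\infty)}=\bigcup_{d\in\mathbb N}\mathbb B^{(d)}$ and let $\mathbb B$ be the closure of $\mathbb B^{(\infty)}$ in the operator norm. The graph $\Gamma$ is approximately uniformly locally finite (AULF) if $L\in\mathbb B$. *)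

(* Defs.v *)
From HB Require Import structures.
From mathcomp Require Import all_boot all_order all_algebra.
From mathcomp Require Import finmap complex.
From mathcomp Require Import all_classical all_reals all_analysis.
From mathcomp Require Import ring lra.

Set Implicit Arguments.
Unset Strict Implicit.
Unset Printing Implicit Defensive.

Import Order.TTheory GRing.Theory Num.Theory.
Import ComplexField.Normc.

Local Open Scope classical_set_scope.
Local Open Scope ring_scope.
Local Open Scope complex_scope.
Local Open Scope card_scope.

Record lfgraph (V : choiceType) := LFGraph {
  adj : rel V;
  adj_sym : symmetric adj;
  adj_irr : irreflexive adj;
  nbr_finite : forall v, finite_set [set w | adj v w] }.

Definition nbr (V : choiceType) (G : lfgraph V) (v : V) : set V :=
  [set w | adj G v w].

Definition deg (V : choiceType) (G : lfgraph V) (v : V) : nat :=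
  #|` fset_set (nbr G v)|.

Definition nbr_deg_le (V : choiceType) (G : lfgraph V) (k : nat) (v : V) : nat :=
  #|` fset_set [set w | adj G v w /\ (deg G w <= k)%N]|.

Section ell2.
Context (R : realType) (V : choiceType).
Local Notation C := R[i].

(* Unordered sum, as V may be uncountable (the graph need not be connected);
   normc is the R-valued modulus of R[i]. *)
Definition sqsum (f : V -> C) : \bar R :=
  \esum_(v in [set: V]) (normc (f v) ^+ 2)%:E.

Definition square_summable : {pred V -> C} := fun f => (sqsum f < +oo)%E.

Lemma sqsum_ge0 (f : V -> C) : (0 <= sqsum f)%E.
Proof. by apply: esum_ge0 => v _; rewrite lee_fin sqr_ge0. Qed.

Lemma esum_mulE (c : R) (a : V -> \bar R) : 0 <= c -> (forall v, 0 <= a v)%E ->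
  (\esum_(v in [set: V]) (c%:E * a v) <= c%:E * \esum_(v in [set: V]) a v)%E.
Proof.
move=> c0 a0; apply: ge_ereal_sup => _ [X XT <-].
rewrite -ge0_mule_fsumr//; apply: lee_wpmul2l; first by rewrite lee_fin.
by apply: esum_ge; exists X.
Qed.

Lemma sqsumD (f g : V -> C) :
  (sqsum (f + g)%R <= 2%:E * (sqsum f + sqsum g))%E.
Proof.
rewrite /sqsum -esumD => [|v _|v _]; rewrite ?lee_fin ?sqr_ge0//.
apply: le_trans (esum_mulE _ _) => //; last first.
  by move=> v; rewrite adde_ge0// lee_fin sqr_ge0.
apply: le_esum => v _; rewrite -EFinD -EFinM lee_fin.
have : normc (f v + g v) ^+ 2 <= (normc (f v) + normc (g v)) ^+ 2.
  by rewrite ler_sqr ?nnegrE ?le_normcD ?addr_ge0 ?sqrtr_ge0//;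
     case: (f v); case: (g v) => *; rewrite ?addr_ge0 ?sqrtr_ge0.
move=> /le_trans; apply; rewrite -subr_ge0.
set a := normc _; set b := normc _.
by rewrite (_ : _ - _ = (a - b) ^+ 2) ?sqr_ge0//; ring.
Qed.

Lemma sqsumZ (c : C) (f : V -> C) :
  (sqsum (c *: f)%R <= (normc c ^+ 2)%:E * sqsum f)%E.
Proof.
rewrite /sqsum; apply: le_trans (esum_mulE _ _); rewrite ?sqr_ge0//; last first.
  by move=> v; rewrite lee_fin sqr_ge0.
apply: le_esum => v _; rewrite -EFinM lee_fin -exprMn -normcM; exact: lexx.
Qed.

Lemma square_summable_submod_closed : submod_closed square_summable.
Proof.
split=> [|c f g fE gE]; rewrite /square_summable unfold_in.
  by rewrite /sqsum esum1// => v _; rewrite normc0 expr0n.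
apply: le_lt_trans (sqsumD _ _) _; rewrite lte_mul_pinfty//.
rewrite lte_add_pinfty//; apply: le_lt_trans (sqsumZ _ _) _.
by rewrite lte_mul_pinfty// lee_fin sqr_ge0.
Qed.

HB.instance Definition _ := GRing.isSubmodClosed.Build _ _ square_summable
  square_summable_submod_closed.

Record ell2 := Ell2 { ell2_fun :> V -> C; _ : ell2_fun \in square_summable }.

HB.instance Definition _ := [isSub for ell2_fun].
HB.instance Definition _ := [Choice of ell2 by <:].
HB.instance Definition _ := [SubChoice_isSubLmodule of ell2 by <:].

Definition ell2_norm (f : ell2) : R := Num.sqrt (fine (sqsum f)).

Definition delta_fun (w : V) : V -> C := fun v => (v == w)%:R.

Lemma delta_square_summable (w : V) : delta_fun w \in square_summable.
Proof.
rewrite unfold_in /square_summable /sqsum (esumID [set w])/=; last first.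
  by move=> v _; rewrite lee_fin sqr_ge0.
rewrite setTI esum_set1 ?lee_fin ?sqr_ge0// esum1 ?adde0 ?ltry//.
move=> v [_ /= /eqP vw]; rewrite /delta_fun (negbTE vw).
by rewrite normc0 expr0n.
Qed.

Definition delta (w : V) : ell2 := Ell2 (delta_square_summable w).

(* Valued in \bar R, so that it is +oo exactly on the unbounded operators. *)
Definition opnorm (T : ell2 -> ell2) : \bar R :=
  ereal_sup [set (ell2_norm (T f))%:E | f in [set f | ell2_norm f <= 1]].

Definition bounded_op : set {linear ell2 -> ell2} :=
  [set T | (opnorm T < +oo)%E].

(* The matrix coefficient in row v and column w, <T delta_w, delta_v>. *)
Definition mx_entry (T : ell2 -> ell2) (v w : V) : C := T (delta w) v.

Definition BBd (d : nat) : set {linear ell2 -> ell2} :=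
  [set T | [/\ bounded_op T,
    forall v, [set w | mx_entry T v w != 0] #<= `I_d &
    forall w, [set v | mx_entry T v w != 0] #<= `I_d]].

Definition BBoo : set {linear ell2 -> ell2} := \bigcup_d BBd d.

(* Closure of BBoo for the operator norm inside the bounded operators. *)
Definition BB : set {linear ell2 -> ell2} :=
  [set T | bounded_op T /\ forall e : R, 0 < e ->
    exists2 S, BBoo S & (opnorm (T \- S)%R < e%:E)%E].

End ell2.

Section laplacian.
Context (R : realType) (V : choiceType) (G : lfgraph V).
Local Notation C := R[i].

Definition laplacian_fun (f : V -> C) : V -> C := fun v =>
  f v - \sum_(w \in nbr G v) ((Num.sqrt (deg G v * deg G w)%:R)^-1)%:C * f w.

Lemma laplacian_funE (f : V -> C) v : laplacian_fun f v =
  f v - \sum_(w <- fset_set (nbr G v))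
    ((Num.sqrt (deg G v * deg G w)%:R)^-1)%:C * f w.
Proof. by rewrite /laplacian_fun fsbig_finite//; exact: nbr_finite. Qed.

Lemma normc_ge0 (x : C) : 0 <= normc x.
Proof. by case: x => a b; rewrite sqrtr_ge0. Qed.

Lemma normc_real (x : R) : 0 <= x -> normc x%:C = x.
Proof. by move=> x0; rewrite /normc /= expr0n addr0 sqrtr_sqr ger0_norm. Qed.

Lemma ler_normc_sum (r : seq V) (F : V -> C) :
  normc (\sum_(w <- r) F w) <= \sum_(w <- r) normc (F w).
Proof.
elim/big_ind2 : _ => [|x a y b xa yb|//]; first by rewrite normc0.
by apply: le_trans (le_normcD _ _) _; exact: lerD.
Qed.

Lemma sqr_sum_le (r : seq V) (x : V -> R) :
  (\sum_(w <- r) x w) ^+ 2 <= (size r)%:R * \sum_(w <- r) x w ^+ 2.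
Proof.
elim: r => [|w r IH]; first by rewrite !big_nil expr0n mulr0.
rewrite !big_cons /= -natr1.
set S := \sum_(_ <- _) _ in IH *; set Q := \sum_(_ <- _) _ in IH *.
set n : R := (size r)%:R in IH *; move: (x w) => a.
have Q0 : 0 <= Q by apply: sumr_ge0 => ? _; rewrite sqr_ge0.
have : 0 <= n by rewrite ler0n.
rewrite le_eqVlt => /orP[/eqP n0|n0].
  have /eqP : S ^+ 2 = 0.
    by apply/eqP; rewrite eq_le sqr_ge0 andbT; rewrite -n0 mul0r in IH.
  rewrite sqrf_eq0 => /eqP ->; rewrite -n0 addr0 add0r mul1r lerDl; exact: Q0.
have h : 0 <= (n * a - S) ^+ 2 by exact: sqr_ge0.
rewrite -(ler_pM2l n0); nra.
Qed.

Lemma laplacian_sum_bound (f : V -> C) v :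
  normc (\sum_(w <- fset_set (nbr G v))
    ((Num.sqrt (deg G v * deg G w)%:R)^-1)%:C * f w) ^+ 2 <=
  \sum_(w <- fset_set (nbr G v)) (deg G w)%:R^-1 * normc (f w) ^+ 2.
Proof.
set r := fset_set _.
pose x w := (Num.sqrt (deg G w)%:R)^-1 * normc (f w).
have [d0|d0] := eqVneq (deg G v) 0%N.
  have -> : r = fset0 by apply/eqP; rewrite -cardfs_eq0; exact/eqP.
  by rewrite !big_seq_fset0 normc0 expr0n.
apply: (@le_trans _ _ ((deg G v)%:R^-1 * (\sum_(w <- r) x w) ^+ 2)).
  rewrite -[X in X^-1](@sqr_sqrtr _ (deg G v)%:R) ?ler0n// -exprVn -exprMn.
  rewrite ler_sqr ?nnegrE ?normc_ge0//; last first.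
    rewrite mulr_ge0 ?invr_ge0 ?sqrtr_ge0// sumr_ge0// => w _.
    by rewrite mulr_ge0 ?invr_ge0 ?sqrtr_ge0 ?normc_ge0.
  apply: le_trans (ler_normc_sum _ _) _; rewrite mulr_sumr; apply: ler_sum => w _.
  by rewrite normcM normc_real ?invr_ge0 ?sqrtr_ge0// natrM sqrtrM ?ler0n// invfM mulrA.
rewrite ler_pdivrMl ?ltr0n ?lt0n//; apply: le_trans (sqr_sum_le _ _) _.
rewrite -[size r]/(deg G v) ler_wpM2l ?ler0n// ler_sum// => w _.
by rewrite exprMn exprVn sqr_sqrtr ?ler0n.
Qed.

Lemma esum_nbr_swap (a : V -> R) : (forall v, 0 <= a v) ->
  (\esum_(v in [set: V]) \esum_(w in nbr G v) (a w)%:E =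
   \esum_(w in [set: V]) \esum_(v in nbr G w) (a w)%:E)%E.
Proof.
move=> a0; rewrite !esum_esum//; try by move=> *; rewrite lee_fin.
rewrite (@reindex_esum _ _ _ ([set: V] `*`` nbr G) _ (fun p => (p.2, p.1)))//.
split=> [[v w] /= [_]|[v w] [v' w'] _ _ /= [-> ->]//|[v w] /= [_ vw]].
  by rewrite /nbr /= adj_sym.
by exists (w, v) => //; split=> //; rewrite /nbr /= adj_sym.
Qed.

Lemma sqsum_laplacian (f : V -> C) :
  (sqsum (laplacian_fun f) <= 4%:E * sqsum f)%E.
Proof.
pose g v := \sum_(w <- fset_set (nbr G v))
    ((Num.sqrt (deg G v * deg G w)%:R)^-1)%:C * f w.
have gf : (sqsum g <= sqsum f)%E.
  pose a w := (deg G w)%:R^-1 * normc (f w) ^+ 2.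
  have a0 w : 0 <= a w by rewrite mulr_ge0 ?invr_ge0 ?sqr_ge0 ?ler0n.
  apply: (@le_trans _ _
      (\esum_(v in [set: V]) \esum_(w in nbr G v) (a w)%:E)%E).
    apply: le_esum => v _; rewrite esum_fset; first last.
    - by move=> w _; rewrite lee_fin.
    - exact: nbr_finite.
    rewrite fsbig_finite; last exact: nbr_finite.
    by rewrite sumEFin lee_fin; exact: laplacian_sum_bound.
  rewrite esum_nbr_swap//; apply: le_esum => w _; rewrite esum_fset; first last.
  - by move=> v _; rewrite lee_fin.
  - exact: nbr_finite.
  rewrite fsbig_finite; last exact: nbr_finite.
  rewrite sumEFin lee_fin big_const_seq count_predT iter_addr addr0.
  rewrite -[size _]/(deg G w) -mulr_natl /a mulrA.
  have [->|d0] := eqVneq (deg G w) 0%N; first by rewrite mul0r mul0r sqr_ge0.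
  by rewrite mulfV ?mul1r// pnatr_eq0.
have -> : laplacian_fun f = (f + (- 1) *: (g : V -> C))%R.
  by apply/funext => v; rewrite laplacian_funE /= scaleN1r.
apply: le_trans (sqsumD _ _) _.
apply: (@le_trans _ _ (2%:E * (sqsum f + sqsum f))%E).
  apply: lee_wpmul2l; rewrite ?lee_fin//; apply: leeD2l.
  apply: le_trans (sqsumZ _ _) _.
  by rewrite normcN normc1 expr1n mul1e.
have := sqsum_ge0 f; case: (sqsum f) => [x| |]//= x0.
  by rewrite -EFinD -!EFinM lee_fin; lra.
by rewrite addye// !gt0_muley ?lte_fin.
Qed.

Lemma laplacian_square_summable (f : ell2 R V) :
  laplacian_fun f \in @square_summable R V.
Proof.
have := valP f; rewrite !unfold_in => fE.
by apply: le_lt_trans (sqsum_laplacian f) _; rewrite lte_mul_pinfty// ?lee_fin.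
Qed.

Definition laplacian_op (f : ell2 R V) : ell2 R V :=
  Ell2 (laplacian_square_summable f).

Lemma laplacian_op_linear : linear laplacian_op.
Proof.
move=> c f g; apply/val_inj/funext => v /=.
rewrite [LHS]laplacian_funE /=.
rewrite -[RHS]/(c * laplacian_fun f v + laplacian_fun g v).
rewrite -[X in X - _]/(c * f v + g v) !laplacian_funE mulrBr addrACA -opprD; congr (_ - _).
rewrite mulr_sumr -big_split; apply: eq_bigr => w _ /=.
by rewrite -[(_ + _ : V -> C) w]/(c * f w + g w) mulrDr mulrCA.
Qed.

HB.instance Definition _ := GRing.isLinear.Build C (ell2 R V) (ell2 R V) _
  laplacian_op laplacian_op_linear.

Definition laplacian : {linear ell2 R V -> ell2 R V} := laplacian_op.

Lemma laplacian_bounded : bounded_op laplacian.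
Proof.
apply: (@le_lt_trans _ _ 2%:E); last by rewrite ltry.
apply: ge_ereal_sup => _ [f /= f1 <-]; rewrite lee_fin.
have := valP f; rewrite unfold_in /= => fE.
have fF : sqsum f \is a fin_num by rewrite ge0_fin_numE// sqsum_ge0.
have LE : (sqsum (laplacian_fun f) < +oo)%E.
  by have := laplacian_square_summable f; rewrite unfold_in.
have LF : sqsum (laplacian_fun f) \is a fin_num by rewrite ge0_fin_numE// sqsum_ge0.
have /fine_le := sqsum_laplacian f.
rewrite fin_numM// => /(_ LF isT); rewrite fineM//= => h.
apply: (@le_trans _ _ (2 * ell2_norm f)); last first.
  by rewrite -[leRHS]mulr1 ler_wpM2l.
rewrite /ell2_norm -[X in X * _]ger0_norm// -sqrtr_sqr -sqrtrM ?sqr_ge0//.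
rewrite ler_sqrt; last by rewrite mulr_ge0 ?sqr_ge0// fine_ge0 ?sqsum_ge0.
by apply: le_trans h _; rewrite (_ : 2 ^+ 2 = 4)// -natrX.
Qed.

Definition AULF : Prop := BB laplacian.

End laplacian.

(* Main.v *)
Require Import Defs.
From mathcomp Require Import all_boot all_order all_algebra.
From mathcomp Require Import finmap complex.
From mathcomp Require Import all_classical all_reals all_analysis.
From mathcomp Require Import ring lra.

Import Order.TTheory GRing.Theory Num.Theory.
Import numFieldNormedType.Exports.
Import ComplexField.Normc.
Local Open Scope classical_set_scope.
Local Open Scope ring_scope.

(** Suppose that [S] approximates the normalized Laplacian [L] within [e] in
    operator norm and has at most [d] non-zero entries in each column.  Look at
    the column of a vertex [u] of degree [D].  Its norm in [L - S] is at most
    [e].  For a neighbour [w] of [u] with [deg w <= k], the squared entry of [L]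
    is [1 / (D * deg w) >= 1 / (D * k.+1)], and [S] can alter at most [d] of
    these entries.  Hence, writing [s] for the number of such neighbours,
    [(s - d) / (D * k.+1) <= e ^ 2], that is,
    [s / D <= k.+1 * e ^ 2 + d / D].

    Along vertices of degree tending to infinity the term [d / D] vanishes for
    each fixed [e] (and so fixed [d]).  As [e] is arbitrary, the ratios [s / D]
    have limit superior at most [0].

    [card_le_of_sparse_column] is the counting inequality for arbitrary
    operators, and [laplacian_entry] computes the entries to which it is
    applied. *)

Lemma ge_limn_esup (R : realType) (u : nat -> \bar R) (c : \bar R) :
  (\forall n \near \oo, (u n <= c)%E) -> (limn_esup u <= c)%E.
Proof.
move=> uc.
apply: (@le_trans _ _ (ereal_sup (u @` [set n | (u n <= c)%E]))).
  by apply: ereal_inf_lbound => /=; exists [set n | (u n <= c)%E].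
by apply: ge_ereal_sup => _ [n /= + <-].
Qed.

Lemma sqsum_delta (R : realType) (V : choiceType) (u : V) :
  sqsum (delta R u) = 1%E.
Proof.
rewrite /sqsum (esumID [set u])/=; last by move=> v _; rewrite lee_fin sqr_ge0.
rewrite setTI esum_set1 ?lee_fin ?sqr_ge0// esum1 => [|v [_ /= /eqP vu]].
  by rewrite adde0 /delta_fun eqxx normc1 expr1n.
by rewrite /delta_fun (negbTE vu) normc0 expr0n.
Qed.

(** The entries of the column of [u] are the coordinates of the image of the
    unit vector [delta u], so any finitely many of them have square sum at most
    the squared operator norm. *)
Lemma column_sum_le (R : realType) (V : choiceType)
    (T : ell2 R V -> ell2 R V) (e : R) (A : {fset V}) (u : V) :
  0 < e -> (opnorm T < e%:E)%E ->
  \sum_(w <- A) normc (mx_entry T w u) ^+ 2 <= e ^+ 2.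
Proof.
move=> e0 Te.
have := valP (T (delta R u)); rewrite unfold_in /= => TF.
have Tfin : sqsum (T (delta R u)) \is a fin_num.
  by rewrite ge0_fin_numE// sqsum_ge0.
have Tn : ell2_norm (T (delta R u)) <= e.
  rewrite -lee_fin; apply: le_trans (ltW Te); apply: ereal_sup_ubound.
  by exists (delta R u) => //=; rewrite /ell2_norm sqsum_delta sqrtr1.
have {}Tn : fine (sqsum (T (delta R u))) <= e ^+ 2.
  rewrite -[leLHS]sqr_sqrtr ?fine_ge0 ?sqsum_ge0//.
  by rewrite ler_sqr ?nnegrE ?sqrtr_ge0 ?(ltW e0).
apply: le_trans Tn; rewrite -lee_fin fineK// -sumEFin.
rewrite -[A]set_fsetK -fsbig_finite//.
by apply: esum_ge; exists [set` A] => //; split.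
Qed.

Lemma laplacian_entry (R : realType) (V : choiceType) (G : lfgraph V) (u w : V) :
  adj G u w ->
  normc (mx_entry (laplacian R G) w u) ^+ 2 =
  ((deg G u * deg G w)%:R)^-1.
Proof.
move=> uw; have wu : w != u.
  by apply: contraTneq uw => ->; rewrite adj_irr.
have wun : u \in fset_set (nbr G w).
  by rewrite in_fset_set ?inE /nbr/= 1?adj_sym//; exact: nbr_finite.
rewrite /mx_entry /= laplacian_funE /= /delta_fun (negbTE wu) sub0r.
rewrite (big_fsetD1 u)//= eqxx mulr1 big_seq big1 => [|z]; last first.
  by rewrite !inE => /andP[/negbTE -> _]; rewrite mulr0.
rewrite addr0 normcN normc_real ?invr_ge0 ?sqrtr_ge0//.
by rewrite exprVn sqr_sqrtr ?ler0n// mulnC.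
Qed.

(** A column of [S] with at most [d] non-zero entries cancels at most [d]
    entries of the same column of [T]; the other entries of [T] indexed by [A]
    survive in [T - S] and each contributes at least [a] to a square sum that
    [column_sum_le] bounds.  The subtraction of [d] is moved to the right-hand
    side so that the case [#|` A| < d] needs no separate treatment. *)
Lemma card_le_of_sparse_column (R : realType) (V : choiceType)
    (T S : ell2 R V -> ell2 R V) (a e : R) (d : nat) (A : {fset V}) (u : V) :
  0 < e -> 0 <= a -> (opnorm (T \- S)%R < e%:E)%E ->
  ([set w | mx_entry S w u != 0%R] #<= `I_d)%card ->
  (forall w, w \in A -> a <= normc (mx_entry T w u) ^+ 2) ->
  #|` A|%:R * a <= e ^+ 2 + d%:R * a.
Proof.
move=> e0 a0 TSe Sd Ta.
have Bfin : finite_set [set w | mx_entry S w u != 0%R].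
  by apply/finite_set_leP; exists d.
set B := fset_set [set w | mx_entry S w u != 0].
have Bd : (#|` B| <= d)%N by exact: geq_card_fset_set.
have ABa : #|` (A `\` B)%fset|%:R * a <= e ^+ 2.
  apply: le_trans (column_sum_le _ _ _ _ (A `\` B)%fset u e0 TSe).
  rewrite mulr_natl -sum1_size -sumrMnr big_seq [leRHS]big_seq.
  apply: ler_sum => w; rewrite !inE in_fset_set// => /andP[wB wA].
  have /eqP Sw0 : mx_entry S w u == 0.
    by apply: contraNT wB => ?; rewrite inE.
  rewrite mulr1n; apply: le_trans (Ta w wA) _.
  by rewrite -[mx_entry (_ \- _) w u]/(mx_entry T w u - mx_entry S w u) Sw0 subr0.
rewrite -lerBlDr -mulrBl; apply: le_trans ABa.
rewrite ler_wpM2r// lerBlDr -natrD ler_nat.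
apply: (@leq_trans (#|` (A `\` B)%fset| + #|` B|)); last by rewrite leq_add2l.
by rewrite cardfsD addnC -leq_subLR leq_sub2l// fsubset_leq_card// fsubsetIr.
Qed.

Theorem theorem4 (R : realType) (V : choiceType) (G : lfgraph V) (v : nat -> V)
  (hdeg : (fun n => deg G (v n)) @ \oo --> \oo)
  (hsup : exists k : nat,
     (0 < limn_esup (fun n =>
        ((nbr_deg_le G k (v n))%:R / (deg G (v n))%:R : R)%:E))%E) :
  ~ AULF R G.
Proof.
move=> [_ approx]; case: hsup => k; apply/negP; rewrite -leNgt.
apply/lee_addgt0Pr => c c0; rewrite add0e; apply: ge_limn_esup.
(* Half of [c] is spent on [k.+1 * e ^ 2], the other half on [d / deg (v n)].
   Taking [k.+1] rather than [k] avoids dividing by zero when [k = 0]. *)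
pose e := Num.sqrt (c / (2 * k.+1%:R)).
have ce0 : 0 < c / (2 * k.+1%:R) by rewrite divr_gt0// mulr_gt0.
have e0 : 0 < e by rewrite sqrtr_gt0.
have e2 : e ^+ 2 * k.+1%:R = c / 2.
  by rewrite sqr_sqrtr ?ltW//; field; rewrite ?pnatr_eq0 // addrC natr1 pnatr_eq0.
have [S [d _ [_ _ Scol]] LS] := approx e e0.
(* The summand [1] makes the degree positive even when [d = 0]. *)
have : \forall n \near \oo, 2 * d%:R / c + 1 <= (deg G (v n))%:R :> R.
  exact: (hdeg _ (nbhs_infty_ger _)).
apply: filterS => n dn; rewrite lee_fin.
have dn0 : 0 < (deg G (v n))%:R :> R.
  apply: lt_le_trans dn; rewrite ltr_wpDl ?divr_ge0 ?mulr_ge0// ltW//.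
set A := fset_set [set w | adj G (v n) w /\ (deg G w <= k)%N].
have Afin : finite_set [set w | adj G (v n) w /\ (deg G w <= k)%N].
  by apply: sub_finite_set (nbr_finite G (v n)) => w [].
have := card_le_of_sparse_column _ _ (laplacian R G) S
  ((deg G (v n))%:R * k.+1%:R)^-1 e d A (v n) e0.
rewrite invr_ge0 mulr_ge0// => /(_ isT LS (Scol _)).
have -> : #|` A| = nbr_deg_le G k (v n) by [].
set s := (nbr_deg_le G k (v n))%:R; move: dn dn0 e2.
set D := (deg G (v n))%:R; set K := k.+1%:R => dn dn0 e2 bound.
have K0 : 0 < K by [].
have {bound} : s * (D * K)^-1 <= e ^+ 2 + d%:R * (D * K)^-1.
  apply: bound => w; rewrite in_fset_set// inE => -[vw wk].
  rewrite laplacian_entry// natrM lef_pV2 ?posrE.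
  - by rewrite ler_wpM2l// ler_nat ltnW.
  - by rewrite mulr_gt0.
  (* [deg G w] is non-zero because [v n] is a neighbour of [w]. *)
  - rewrite mulr_gt0// ltr0n lt0n cardfs_eq0; apply/fset0Pn; exists (v n).
    by rewrite in_fset_set ?inE /nbr/= 1?adj_sym//; exact: nbr_finite.
rewrite -(ler_pM2r K0) mulrDl e2 invfM !mulrA !mulfVK ?gt_eqF// => h.
apply: le_trans h _.
have : d%:R / D <= c / 2; last by lra.
rewrite ler_pdivrMr//; move: dn; rewrite -lerBrDr ler_pdivrMr//; nra.
Qed.
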